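(* Let $T>0$. Let $L,R:[0,T]\times\mathbb{R}\to\mathbb{R}$ satisfy conditions (LR) and (LR-smooth), and let $\xi$, $f$ satisfy condition (Lip-k) (all stated in the context). Let $(\widetilde Y,\widetilde Z,\widetilde K)\in\mathcal{S}^2\times\mathcal{H}^2\times BV[0,T]$ be the unique solution of $$\begin{cases} \widetilde Y_t=\xi+\int_t^T f(s,\widetilde Y_s,\mathbf{E}[\widetilde Y_s],\widetilde Z_s,\mathbf{E}[\widetilde Z_s],0)\,ds-\int_t^T\widetilde Z_s\,dB_s+\widetilde K_T-\widetilde K_t,\\ \mathbf{E}[L(t,\widetilde Y_t)]\le0\le\mathbf{E}[R(t,\widetilde Y_t)],\\ \widetilde K_t=\widetilde K^+_t-\widetilde K^-_t,\quad \widetilde K^+,\widetilde K^-\in I[0,T],\\ \int_0^T\mathbf{E}[R(t,\widetilde Y_t)]\,d\widetilde K^+_t=\int_0^T\mathbf{E}[L(t,\widetilde Y_t)]\,d\widetilde K^-_t=0, \end{cases}$$ and suppose $\sup_{t\in[0,T]}\mathbf{E}[|\widetilde Z_t|^2]<\infty$, so that $\widetilde K^{\pm}_t=\int_0^t\widetilde k^{\pm}_s\,ds$ for some measurable functions $\widetilde k^+,\widetilde k^-\ge0$. Moreover, suppose that for any $s\in[0,T]$ each of the following two equations (in the unknown $k$) admits a unique deterministic nonnegative solution: $$\begin{aligned} &f(s,\widetilde Y_s,\mathbf{E}[\widetilde Y_s],\widetilde Z_s,\mathbf{E}[\widetilde Z_s],k)-f(s,\widetilde Y_s,\mathbf{E}[\widetilde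 Y_s],\widetilde Z_s,\mathbf{E}[\widetilde Z_s],0)+k=\widetilde k^+_s,\\ &f(s,\widetilde Y_s,\mathbf{E}[\widetilde Y_s],\widetilde Z_s,\mathbf{E}[\widetilde Z_s],-k)-f(s,\widetilde Y_s,\mathbf{E}[\widetilde Y_s],\widetilde Z_s,\mathbf{E}[\widetilde Z_s],0)-k=-\widetilde k^-_s. \end{aligned}$$ Then the system $$\begin{cases} Y_t=\xi+\int_t^T\big(f(s,Y_s,\mathbf{E}[Y_s],Z_s,\mathbf{E}[Z_s],k_s)+k_s\big)\,ds-\int_t^TZ_s\,dB_s,\quad t\in[0,T],\\ \mathbf{E}[L(t,Y_t)]\le0\le\mathbf{E}[R(t,Y_t)],\quad t\in[0,T],\\ k_t=k^+_t-k^-_t,\quad t\in[0,T],\quad k^+,k^-\ge0,\\ \int_0^T\mathbf{E}[R(t,Y_t)]k^+_t\,dt=\int_0^T\mathbf{E}[L(t,Y_t)]k^-_t\,dt=0 \end{cases}$$ has at least one solution $(Y,Z,k)$.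
   Context: Setting: $(\Omega,\mathcal{F},\mathbb{F},\mathbf{P})$ is a filtered probability space satisfying the usual conditions, carrying a one-dimensional standard Brownian motion $B$; $\mathbb{F}$ is the augmented natural filtration of $B$. Spaces: $\mathcal{L}^2_T$: square-integrable $\mathcal{F}_T$-measurable random variables. $\mathcal{S}^2$: real adapted continuous processes $y$ on $[0,T]$ with $\mathbf{E}[\sup_t|y_t|^2]<\infty$. $\mathcal{H}^2$: real progressively measurable $z$ with $\mathbf{E}[\int_0^T|z_t|^2dt]<\infty$. $BV[0,T]$: (deterministic) continuous functions of bounded variation on $[0,T]$ vanishing at $0$. $I[0,T]$: (deterministic) continuous nondecreasing functions on $[0,T]$ starting from $0$. A solution of the last system is a triple $(Y,Z,k)$ with $Y\in\mathcal{S}^2$, $Z\in\mathcal{H}^2$ and $k$ a deterministic measurable function on $[0,T]$ for which the system holds. Condition (LR): (1) $L(\cdot,x)$ and $R(\cdot,x)$ are continuous for each $x$; (2) $\sup_{t}|L(t,0)|+\sup_t|R(t,0)|\le M$ for some $M>0$; (3) $L(t,\cdot),R(t,\cdot)$ are strictly increasing and there are $0<c<C$ with $c|x-y|\le|L(t,x)-L(t,y)|\le C|x-y|$ and $c|x-y|\le|R(t,x)-R(t,y)|\le C|x-y|$ for all $t,x,y$; (4) $\inf_{t,x}(R(t,x)-L(t,x))>0$. Condition (LR-smooth): $L,R\in C^{1,2}_b([0,T]\times\mathbb{R})$, i.e. they are continuously differentiable in the first variable and twice continuously differentiable in the second variable, with uniformly bounded derivatives. Condition (Lip-k): $\xi\in\mathcal{L}^2_T$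 with $\mathbf{E}[L(T,\xi)]\le0\le\mathbf{E}[R(T,\xi)]$; $f:[0,T]\times\Omega\times\mathbb{R}^5\to\mathbb{R}$, $(t,\omega,y,y',z,z',k)\mapsto f(t,y,y',z,z',k)$, is jointly measurable and progressively measurable in $(t,\omega)$; $f(\cdot,0,0,0,0,0)\in\mathcal{H}^2$; and there is $\lambda>0$ such that for all $t$, $k$ and all real arguments, $|f(t,y_1,y_1',z_1,z_1',k)-f(t,y_2,y_2',z_2,z_2',k)|\le\lambda(|y_1-y_2|+|y_1'-y_2'|+|z_1-z_2|+|z_1'-z_2'|)$. *)

(* Defs.v *)
From HB Require Import structures.
From mathcomp Require Import all_boot all_order all_algebra.
From mathcomp Require Import all_classical all_reals all_analysis.

Set Implicit Arguments.
Unset Strict Implicit.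
Unset Printing Implicit Defensive.

Import Order.TTheory GRing.Theory Num.Theory.
Import numFieldNormedType.Exports.

Local Open Scope classical_set_scope.
Local Open Scope ring_scope.

(* Processes and deterministic functions of time are indexed by all of R; only
   their values on [0, T] are ever constrained or used. *)

Section deterministic.
Context {R : realType}.
Implicit Types (T : R) (L Up : R -> R -> R) (K : R -> R).

(* L and Up are the lower and upper loss functions; c and C serve for both. *)
Definition cond_LR T L Up : Prop :=
  [/\ forall x, {within `[0, T], continuous (fun t => L t x)} /\
                {within `[0, T], continuous (fun t => Up t x)},
      exists2 M : R, 0 < M &
        (ereal_sup [set `|L t 0|%:E | t in `[0%R, T]]
         + ereal_sup [set `|Up t 0|%:E | t in `[0%R, T]] <= M%:E)%E,
      forall t, t \in `[0, T] ->
        {homo L t : x y / x < y} /\ {homo Up t : x y / x < y},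
      exists c C : R, [/\ 0 < c, c < C &
        forall t x y, t \in `[0, T] ->
          c * `|x - y| <= `|L t x - L t y| <= C * `|x - y| /\
          c * `|x - y| <= `|Up t x - Up t y| <= C * `|x - y|] &
      (0%:E < ereal_inf [set (Up p.1 p.2 - L p.1 p.2)%:E
                        | p in `[0%R, T] `*` [set: R]])%E].

(* C^{1,2}_b([0, T] x R). The time derivative is taken within [0, T], hence is
   one-sided at the end points. *)
Definition C12b T (g : R -> R -> R) : Prop :=
  exists gt gx gxx : R -> R -> R,
  [/\ forall t x, t \in `[0, T] -> [/\
        (g s x - g t x) / (s - t) @[s --> within `[0, T] t^'] --> gt t x,
        is_derive x 1 (g t) (gx t x) &
        is_derive x 1 (gx t) (gxx t x)],
      {within `[0, T] `*` [set: R], continuous (fun p : R * R => gt p.1 p.2)},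
      {within `[0, T] `*` [set: R], continuous (fun p : R * R => gx p.1 p.2)},
      {within `[0, T] `*` [set: R], continuous (fun p : R * R => gxx p.1 p.2)} &
      exists M : R, forall t x, t \in `[0, T] ->
        [/\ `|gt t x| <= M, `|gx t x| <= M & `|gxx t x| <= M]].

Definition BV0 T K : Prop :=
  [/\ K 0 = 0, {within `[0, T], continuous K} & bounded_variation 0 T K].

(* the set I[0, T] *)
Record incr0 T := Incr0 {
  incr0_fun :> R -> R ;
  incr0_at0 : incr0_fun 0 = 0 ;
  incr0_cont : {within `[0, T], continuous incr0_fun} ;
  incr0_homo : {in `[0, T] &, {homo incr0_fun : x y / x <= y}} }.

Definition clamp T (t : R) : R := Num.max 0 (Num.min t T).

(* K extended to R by constants on both sides of [0, T]; since it is continuous,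
   its Stieltjes measure puts no mass on {0} *)
Definition incr0_ext T (K : incr0 T) : R -> R := fun t => K (clamp T t).

Lemma clamp_in T t : 0 <= T -> clamp T t \in `[0, T].
Proof.
move=> T0; rewrite /clamp in_itv/= le_max lexx/=.
by rewrite ge_max T0/= ge_min lexx orbT.
Qed.

Lemma clamp_homo T : {homo clamp T : x y / x <= y}.
Proof.
move=> x y xy; rewrite /clamp ge_max !le_max lexx/=.
by rewrite le_min !ge_min xy lexx !orbT.
Qed.

Lemma clamp_neg T t : T < 0 -> clamp T t = 0.
Proof.
by move=> T0; apply/max_idPl; rewrite ge_min (ltW T0) orbT.
Qed.

Lemma continuous_clamp T : continuous (clamp T).
Proof.
move=> t; apply: (@continuous_max R R (fun=> 0) (fun t => Num.min t T)).
  exact: cvg_cst.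
by apply: (@continuous_min R R id (fun=> T)); [exact: cvg_id|exact: cvg_cst].
Qed.

Lemma incr0_ext_nd T (K : incr0 T) : nondecreasing (incr0_ext K).
Proof.
move=> x y xy; rewrite /incr0_ext; have [T0|T0] := leP 0 T.
  by apply: incr0_homo; rewrite ?clamp_in//; exact: clamp_homo.
by rewrite !clamp_neg.
Qed.

Lemma continuous_incr0_ext T (K : incr0 T) : continuous (incr0_ext K).
Proof.
move=> t; have [T0|T0] := leP 0 T; last first.
  have -> : incr0_ext K = fun=> K 0.
    by apply/funext => s; rewrite /incr0_ext clamp_neg.
  exact: cst_continuous.
have /subspace_continuousP Kc := @incr0_cont T K.
have tT := clamp_in t T0.
apply: (@cvg_comp _ _ _ (clamp T) K _ _ _ _ (Kc _ tT)) => A cA.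
have clA : \forall s \near t, clamp T s \in `[0, T] -> A (clamp T s).
  exact: (@continuous_clamp T t _ cA).
suff : \forall s \near t, A (clamp T s) by [].
by near=> s; have /(_ (clamp_in s T0)) : clamp T s \in `[0, T] -> A (clamp T s)
  by near: s.
Unshelve. all: by end_near.
Qed.

Lemma incr0_ext_rc T (K : incr0 T) : right_continuous (incr0_ext K).
Proof.
by move=> t; apply: cvg_at_right_filter; exact: continuous_incr0_ext.
Qed.

HB.instance Definition _ T (K : incr0 T) :=
  isCumulative.Build R _ R (incr0_ext K)
    (@incr0_ext_nd T K) (@incr0_ext_rc T K).

End deterministic.

Section stochastic.
Context {R : realType} {d : measure_display} {Omega : measurableType d}.
Variable P : probability Omega R.
Implicit Types (T : R) (F : R -> set (set Omega)) (X Y Z M B : R -> Omega -> R)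
  (xi : Omega -> R) (K : R -> R) (L Up : R -> R -> R).
Implicit Types f : R -> Omega -> R -> R -> R -> R -> R -> R.

Local Notation mu := (@lebesgue_measure R).

Definition mean (X : Omega -> R) : R := fine 'E_P[X].

Definition filtration T F : Prop :=
  (forall t, t \in `[0, T] ->
     sigma_algebra [set: Omega] (F t) /\ F t `<=` measurable) /\
  (forall s t, 0 <= s -> s <= t -> t <= T -> F s `<=` F t).

Definition usual_conditions T F : Prop :=
  [/\ measure_is_complete P,
      forall N, P.-negligible N -> F 0 N &
      forall t, 0 <= t < T -> F t = \bigcap_(s in `]t, T]) F s].

Definition augmented_natural_filtration B (t : R) : set (set Omega) :=
  <<s [set A | exists s U, [/\ s \in `[0, t], measurable U & A = B s @^-1` U]]
      `|` [set N | P.-negligible N] >>.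

Definition measurable_wrt (G : set (set Omega)) (X : Omega -> R) : Prop :=
  measurable_fun setT (X : g_sigma_algebraType G -> R).

Definition adapted T F X : Prop :=
  forall t, t \in `[0, T] -> measurable_wrt (F t) (X t).

Definition progressive T F X : Prop :=
  forall t, t \in `[0, T] ->
    measurable_fun (`[0, t] `*` [set: g_sigma_algebraType (F t)])
      (fun p => X p.1 p.2).

(* standard Brownian motion on [0, T] relative to the filtration F *)
Definition brownian_motion T F B : Prop :=
  [/\ adapted T F B,
      {ae P, forall w, B 0 w = 0},
      {ae P, forall w, {within `[0, T], continuous (fun t => B t w)}},
      forall s t U, 0 <= s -> s < t -> t <= T -> measurable U ->
        P ((B t \- B s)%R @^-1` U) = normal_prob 0 (Num.sqrt (t - s)) U &
      forall s t A U, 0 <= s -> s < t -> t <= T -> F s A -> measurable U ->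
        P (A `&` (B t \- B s)%R @^-1` U)
        = (P A * P ((B t \- B s)%R @^-1` U))%E].

Definition L2_rv T F xi : Prop :=
  measurable_wrt (F T) xi /\ ('E_P[fun w => (xi w ^+ 2)%R] < +oo)%E.

Definition S2 T F Y : Prop :=
  [/\ adapted T F Y,
      forall w, {within `[0, T], continuous (fun t => Y t w)} &
      (\int[P]_w ereal_sup [set (`|Y t w| ^+ 2)%:E | t in `[0%R, T]] < +oo)%E].

Definition H2 T F Z : Prop :=
  progressive T F Z /\
  (\int[P]_w \int[mu]_(t in `[0%R, T]) (`|Z t w| ^+ 2)%:E < +oo)%E.

(* the elementary process \sum_i H_i 1_]a_i, b_i] *)
Record elementary := Elementary {
  el_size : nat ;
  el_left : 'I_el_size -> R ;
  el_right : 'I_el_size -> R ;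
  el_coef : 'I_el_size -> Omega -> R }.

Definition is_elementary T F (S : elementary) : Prop :=
  forall i : 'I_(el_size S),
    [/\ 0 <= el_left i, el_left i <= el_right i, el_right i <= T,
        measurable_wrt (F (el_left i)) (el_coef i) &
        exists C : R, forall w, `|el_coef i w| <= C].

Definition elementary_fun (S : elementary) (t : R) (w : Omega) : R :=
  \sum_(i < el_size S) el_coef i w * \1_(`]el_left i, el_right i]) t.

Definition elementary_int B (S : elementary) (t : R) (w : Omega) : R :=
  \sum_(i < el_size S)
    el_coef i w * (B (Num.min (el_right i) t) w - B (Num.min (el_left i) t) w).

(* M is (a continuous version of) the Ito integral process
   (\int_0^t Z_s dB_s)_{t in [0, T]}: the L^2-limit of the integrals of
   elementary processes converging to Z in H^2. By the Ito isometry, M exists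
   for Z in H^2 and is unique up to indistinguishability. *)
Definition ito_integral T F B Z M : Prop :=
  [/\ adapted T F M,
      forall w, {within `[0, T], continuous (fun t => M t w)} &
      exists S : nat -> elementary,
      [/\ forall n, is_elementary T F (S n),
          (\int[P]_w \int[mu]_(t in `[0%R, T])
             (`|elementary_fun (S n) t w - Z t w| ^+ 2)%:E)%E
            @[n --> \oo] --> 0%:E &
          forall t, t \in `[0, T] ->
            'E_P[fun w => ((elementary_int B (S n) t w - M t w) ^+ 2)%R]%E
              @[n --> \oo] --> 0%:E]].

(* Y_t = xi + \int_t^T g_s ds - \int_t^T Z_s dB_s + K_T - K_t on [0, T],
   almost surely, the Lebesgue integral being well defined *)
Definition backward_equation T F B xi (g : R -> Omega -> R) Y Z K : Prop :=
  exists M, ito_integral T F B Z M /\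
    {ae P, forall w,
       mu.-integrable `[0, T] (fun s => (g s w)%:E) /\
       forall t, t \in `[0, T] ->
         Y t w = xi w + \int[mu]_(s in `[t, T]) g s w
                 - (M T w - M t w) + (K T - K t)}.

Definition mean_constraint T L Up Y : Prop :=
  forall t, t \in `[0, T] ->
    ('E_P[fun w => L t (Y t w)] <= 0 /\ 0 <= 'E_P[fun w => Up t (Y t w)])%E.

Definition cond_Lip_k T F L Up xi f : Prop :=
  [/\ L2_rv T F xi,
      ('E_P[fun w => L T (xi w)] <= 0 /\ 0 <= 'E_P[fun w => Up T (xi w)])%E,
      measurable_fun
        [set p : R * Omega * R * R * R * R * R | 0 <= p.1.1.1.1.1.1 <= T]
        (fun p => f p.1.1.1.1.1.1 p.1.1.1.1.1.2
                    p.1.1.1.1.2 p.1.1.1.2 p.1.1.2 p.1.2 p.2) /\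
      (forall y y' z z' k, progressive T F (fun t w => f t w y y' z z' k)),
      H2 T F (fun t w => f t w 0 0 0 0 0) &
      exists2 lambda : R, 0 < lambda &
        {ae P, forall w, forall t k y1 y1' z1 z1' y2 y2' z2 z2',
          t \in `[0, T] ->
          `|f t w y1 y1' z1 z1' k - f t w y2 y2' z2 z2' k| <=
          lambda * (`|y1 - y2| + `|y1' - y2'| + `|z1 - z2| + `|z1' - z2'|)}].

(* f(s, Y_s, E[Y_s], Z_s, E[Z_s], k) *)
Definition mf_driver f Y Z (s : R) (k : R) (w : Omega) : R :=
  f s w (Y s w) (mean (Y s)) (Z s w) (mean (Z s)) k.

(* (Y, Z, K), with K = Kp - Km, solves the doubly mean reflected equation with
   driver f(., 0) *)
Definition reflected_solution T F B L Up xi f Y Z K (Kp Km : incr0 T) : Prop :=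
  [/\ S2 T F Y /\ H2 T F Z /\ BV0 T K,
      backward_equation T F B xi (fun s w => mf_driver f Y Z s 0 w) Y Z K,
      mean_constraint T L Up Y,
      forall t, t \in `[0, T] -> K t = Kp t - Km t &
      (\int[lebesgue_stieltjes_measure (incr0_ext Kp)]_(t in `[0%R, T])
          'E_P[fun w => Up t (Y t w)] = 0 /\
       \int[lebesgue_stieltjes_measure (incr0_ext Km)]_(t in `[0%R, T])
          'E_P[fun w => L t (Y t w)] = 0)%E].

(* k is a density on [0, T] of the increasing function K *)
Definition is_density T K (k : R -> R) : Prop :=
  [/\ measurable_fun `[0, T] k, forall t, t \in `[0, T] -> 0 <= k t &
      forall t, t \in `[0, T] -> (K t)%:E = (\int[mu]_(s in `[0%R, t]) (k s)%:E)%E].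

(* (Y, Z, k) solves the mean reflected equation whose driver depends on k *)
Definition resistance_solution T F B L Up xi f Y Z (k : R -> R) : Prop :=
  [/\ S2 T F Y /\ H2 T F Z /\ measurable_fun `[0, T] k,
      backward_equation T F B xi (fun s w => mf_driver f Y Z s (k s) w + k s)
        Y Z (fun=> 0),
      mean_constraint T L Up Y &
      exists kp km : R -> R,
      [/\ measurable_fun `[0, T] kp /\ measurable_fun `[0, T] km,
          forall t, t \in `[0, T] ->
            [/\ k t = kp t - km t, 0 <= kp t & 0 <= km t] &
          (\int[mu]_(t in `[0%R, T])
             ('E_P[fun w => Up t (Y t w)] * (kp t)%:E) = 0 /\
           \int[mu]_(t in `[0%R, T])
             ('E_P[fun w => L t (Y t w)] * (km t)%:E) = 0)%E]].

End stochastic.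

(* Main.v *)
From HB Require Import structures.
Require Import Defs.
From mathcomp Require Import all_boot all_order all_algebra.
From mathcomp Require Import all_classical all_reals all_analysis.
From mathcomp Require Import measurable_realfun ring.

Set Implicit Arguments.
Unset Strict Implicit.
Unset Printing Implicit Defensive.

Import Order.TTheory GRing.Theory Num.Theory.
Import numFieldNormedType.Exports.

Local Open Scope classical_set_scope.
Local Open Scope ring_scope.

(* Keep (Y, Z) and take k = a - b, where a_s and b_s are the solutions of the
   two auxiliary equations. Since E[Up(t, Y_t)] and E[L(t, Y_t)] cannot vanish
   together, flatness gives k~+ k~- = 0 almost everywhere; by uniqueness a
   vanishes with k~+ and b with k~-, so that, for almost every s,
   f(s, ..., k_s) + k_s = f(s, ..., 0) + k~+_s - k~-_s almost surely, and the
   flatness of a and b follows from that of k~+ and k~-.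
   The delicate point is the measurability of a and b. By Fubini their graphs
   are Borel subsets of the plane, and a function with a Borel graph is Borel:
   {a > c} and its complement are disjoint projections of Borel sets, hence are
   separated by a Borel set (Lusin). *)

(** * Functions with a Borel graph *)

Section measurable_graph.
Context {R : realType}.
Local Notation W := (R * R * (nat -> nat))%type.
Implicit Types (p q : W) (A B C : set W).

(* A basis of the product topology on R * R * nat^nat. *)
Definition close n p q : Prop :=
  [/\ `|p.1.1 - q.1.1| <= n.+1%:R^-1, `|p.1.2 - q.1.2| <= n.+1%:R^-1 &
      forall i, (i < n)%N -> p.2 i = q.2 i].

(* C is closed in R * R * nat^nat. *)
Definition sclosed C : Prop :=
  forall p, (forall n, exists2 q, C q & close n p q) -> C p.

(** Suslin sets of the plane. Baire space is taken as parameter space because one sequence can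
    encode an index followed by a sequence, or countably many sequences; this gives closure under
    countable unions and intersections. *)
Definition analytic (G : set (R * R)) : Prop :=
  exists2 C, sclosed C & G = [set x | exists s, C (x, s)].

Lemma close_le m n p q : (m <= n)%N -> close n p q -> close m p q.
Proof.
move=> mn [h1 h2 h3]; split; last by move=> i im; apply/h3/(leq_trans im).
- by apply: (le_trans h1); rewrite lef_pV2 ?posrE ?ltr0n// ler_nat.
- by apply: (le_trans h2); rewrite lef_pV2 ?posrE ?ltr0n// ler_nat.
Qed.

(** The head of the parameter sequence selects the index, its tail is the witness for the selected
    set. *)
Lemma analytic_bigcup (G : nat -> set (R * R)) :
  (forall n, analytic (G n)) -> analytic (\bigcup_n G n).
Proof.
move=> /(_ _)/cid2-/all_sig2[C cC GC].
exists [set p | C (p.2 0%N) (p.1, fun i => p.2 i.+1)].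
  (* One level more than required: the approximating sequence must share the head [s 0], and the
     shift costs one entry. *)
  move=> [x s] h; rewrite /=.
  apply: cC => n; have [[y t] Cy ct] := h n.+1.
  have [_ _ ts] := ct; rewrite /= in Cy ts.
  exists (y, fun i => t i.+1); first by rewrite (ts 0%N).
  have [h1 h2 h3] := close_le (leqnSn n) ct.
  by split => //= i ilt; apply: ts.
rewrite eqEsubset; split => x /=.
  move=> [n _]; rewrite GC => -[s Cs].
  by exists (fun i => if i is j.+1 then s j else n).
by move=> [s Cs]; exists (s 0%N) => //; rewrite GC; exists (fun i => s i.+1).
Qed.

(** The pairing [pickle] packs one witness for each [G n] into a single sequence, and [dec] unpacks
    the [n]-th. *)
Lemma analytic_bigcap (G : nat -> set (R * R)) :
  (forall n, analytic (G n)) -> analytic (\bigcap_n G n).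
Proof.
move=> /(_ _)/cid2-/all_sig2[C cC GC].
pose dec (s : nat -> nat) (n i : nat) := s (pickle (n, i)).
exists [set p | forall n, C n (p.1, dec p.2 n)].
  move=> [x s] h n; rewrite /=.
  (* Agreement of two sequences below [N] forces agreement of the first [m] entries of their [n]-th
     decoded sequences. *)
  apply: cC => m; pose N := maxn m (\max_(i < m) (pickle (n, val i)).+1).
  have [[y t] Cy ct] := h N.
  exists (y, dec t n); first exact: Cy.
  have [_ _ h3] := ct.
  have [h1 h2 _] := close_le (leq_maxl m _) ct.
  split => //= i ilt; apply: h3; rewrite leq_max; apply/orP; right.
  exact: (@leq_bigmax _ (fun i : 'I_m => (pickle (n, val i)).+1) (Ordinal ilt)).
rewrite eqEsubset; split => x /=.
  move=> Gx; have /(_ _)/cid-/all_sig[s Cs] : forall n, exists s, C n (x, s).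
    by move=> n; have := Gx n I; rewrite GC.
  exists (fun j => if unpickle j is Some (n, i) then s n i else 0%N) => n /=.
  rewrite (_ : dec _ n = s n)//; apply/funext => i.
  by rewrite /dec pickleK.
by move=> [s Cs] n _; rewrite GC; exists (dec s n).
Qed.

Lemma le_approx (a b : R) :
  (forall n, exists2 c, a <= c & `|b - c| <= n.+1%:R^-1) -> a <= b.
Proof.
move=> H; apply/ler_addgt0Pr => e e0.
have [n _ ne] := near_infty_natSinv_lt (PosNum e0).
have [c ac] := H n.
rewrite distrC => /ler_distlDr/(le_trans ac)/le_trans; apply.
by rewrite lerD2l; exact/ltW/(ne n (leqnn n)).
Qed.

(** The strict inequality is a union of the closed conditions [c + 1/(n+1) <= h x]; the first entry
    of the parameter sequence plays the role of [n]. *)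
Lemma analytic_gt (h : R * R -> R) (c : R) :
  (forall p q n, close n p q -> `|h p.1 - h q.1| <= n.+1%:R^-1) ->
  analytic [set x | c < h x].
Proof.
move=> hc; exists [set p | c + (p.2 0%N).+1%:R^-1 <= h p.1].
  move=> p H /=; apply: le_approx => n; have [q /= Cq cq] := H n.+1.
  exists (h q.1); first by have [_ _ ->] := cq.
  exact/hc/close_le/cq.
rewrite eqEsubset; split => x /=.
  rewrite -subr_gt0 => e0; have [n _ ne] := near_infty_natSinv_lt (PosNum e0).
  by exists (fun=> n); rewrite -lerBrDl; exact/ltW/(ne n (leqnn n)).
by case=> s; apply: lt_le_trans; rewrite ltrDl invr_gt0 ltr0n.
Qed.

Lemma analytic_le (h : R * R -> R) (c : R) :
  (forall p q n, close n p q -> `|h p.1 - h q.1| <= n.+1%:R^-1) ->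
  analytic [set x | h x <= c].
Proof.
move=> hc; exists [set p | h p.1 <= c].
  move=> p H /=; rewrite -lerN2; apply: le_approx => n.
  have [q /= Cq cq] := H n; exists (- h q.1); first by rewrite lerN2.
  by rewrite -opprD normrN; exact: hc.
rewrite eqEsubset; split => x /= hx; first by exists (fun=> 0%N).
by case: hx.
Qed.

Definition bianalytic : set (set (R * R)) :=
  [set G | analytic G /\ analytic (~` G)].

Lemma sigma_algebra_bianalytic : sigma_algebra setT bianalytic.
Proof.
split.
- have a0 : analytic set0.
    by exists set0 => [p /(_ 0%N)[]|]//; rewrite eqEsubset; split => x // -[].
  have aT : analytic setT.
    by exists setT => //; rewrite eqEsubset; split => x // _; exists (fun=> 0%N).
  by split=> //; rewrite setC0.
- by move=> A [aA aC]; rewrite setTD; split => //; rewrite setCK.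
- move=> A hA; split; first by apply: analytic_bigcup => n; case: (hA n).
  by rewrite setC_bigcup; apply: analytic_bigcap => n; case: (hA n).
Qed.

(** Bianalytic sets form a sigma-algebra, so it suffices that both coordinates are measurable for
    it; their rays are handled by [analytic_gt] and [analytic_le]. *)
Lemma measurable_bianalytic (G : set (R * R)) : measurable G -> bianalytic G.
Proof.
move=> mG; pose S := g_sigma_algebraType bianalytic.
suff mid : measurable_fun [set: S] (fun x => x : R * R).
  have := mid measurableT G mG; rewrite setTI => h.
  by rewrite -(sigma_algebra_id sigma_algebra_bianalytic).
have key (h : R * R -> R) :
    (forall p q n, close n p q -> `|h p.1 - h q.1| <= n.+1%:R^-1) ->
    measurable_fun [set: S] h.
  move=> hc; apply: (measurability _ (RGenOInfty.measurableE R)).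
  move=> _ [_ [c ->] <-]; rewrite setTI.
  apply: sub_gen_smallest; rewrite /bianalytic/=.
  have -> : h @^-1` `]c, +oo[ = [set x | c < h x].
    by apply/seteqP; split => x /=; rewrite in_itv/= andbT.
  split; first exact: analytic_gt.
  have -> : ~` [set x | c < h x] = [set x | h x <= c].
    by apply/seteqP; split => x /=; rewrite leNgt => /negP.
  exact: analytic_le.
by apply/measurable_fun_pairP; split; apply: key => p q n [].
Qed.

(** * Borel separation over the first coordinate *)

Definition separated A B : Prop :=
  exists2 S : set R, measurable S &
    (forall p, A p -> S p.1.1) /\ (forall p, B p -> ~ S p.1.1).

Lemma separated_bigcup (I : countType) (A B : I -> set W) :
  (forall i j, separated (A i) (B j)) ->
  separated (\bigcup_i A i) (\bigcup_j B j).
Proof.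
move=> /(_ _ _)/cid2 h.
pose S i j := s2val (h i j).
(* The separator is the union over [i] of the intersections over [j] of [S i j]. *)
exists (\bigcup_i ~` (\bigcup_j ~` S i j)).
  apply: countable_bigcupT_measurable => // i; apply: measurableC.
  apply: countable_bigcupT_measurable => // j; apply: measurableC.
  by rewrite /S; case: (h i j).
split.
  move=> p [i _ Ai]; exists i => //= -[j _]; apply.
  by rewrite /S; case: (h i j) => s /= _ []; move=> + _; exact.
move=> p [j _ Bj] [i _]; apply; exists j => //=.
by rewrite /S; case: (h i j) => s /= _ [_]; exact.
Qed.

(** The address of [p] at level [n]: the grid intervals of mesh [1/(n+1)] holding its two real
    coordinates, and the [n]-th entry of its sequence. There are countably many addresses, so the
    cells of a level form a countable partition. *)
Definition code n p : int * int * nat :=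
  (Num.floor (p.1.1 * n.+1%:R), Num.floor (p.1.2 * n.+1%:R), p.2 n).

Definition cell A n c := A `&` [set p | code n p = c].

Lemma floor_mul_itv n (z : int) : [set x : R | Num.floor (x * n.+1%:R) = z] =
  [set` `[z%:~R / n.+1%:R, z%:~R / n.+1%:R + n.+1%:R^-1[].
Proof.
apply/seteqP; split => x /=; rewrite in_itv/= -[X in _ + X]mul1r -mulrDl;
  rewrite ler_pdivrMr ?ltr0n// ltr_pdivlMr ?ltr0n// (_ : 1 = 1%:~R)// -intrD.
  by move=> <-; rewrite floor_le floorD1_gt.
by move/floor_def.
Qed.

(** By contraposition: if all pairs of cells over a common first interval were separated, then all
    pairs of cells would be, and [separated_bigcup] would separate [A] from [B]. *)
Lemma separated_refine A B n : ~ separated A B ->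
  exists cd, cd.1.1.1 = cd.2.1.1 /\
    ~ separated (cell A n cd.1) (cell B n cd.2).
Proof.
move=> nAB; apply: contrapT => H; apply: nAB.
have cellE A' : A' = \bigcup_c cell A' n c.
  by apply/seteqP; split => [p Ap|p [c _ []]//]; exists (code n p).
rewrite (cellE A) (cellE B); apply: separated_bigcup => c d.
have [cd|/eqP cd] := eqVneq c.1.1 d.1.1.
  by apply: contrapT => ncd; apply: H; exists (c, d).
(* Cells over distinct first intervals are separated by the interval itself. *)
exists [set x | Num.floor (x * n.+1%:R) = c.1.1].
  by rewrite floor_mul_itv; exact: measurable_itv.
split => [p [_ /= cp]|p [_ /= dp] /= pc]; first by rewrite /= -cp.
by apply: cd; rewrite -pc -dp.
Qed.

(* The common point of the intervals [a i / (i + 1), (a i + 1) / (i + 1)]. *)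
Definition cell_limit (a : nat -> int) : R :=
  sup (range (fun i => (a i)%:~R / i.+1%:R)).

(** Any two of the intervals share a point, so every left end lies below every right end and the
    supremum of the left ends lies in each closed interval. The [n]-th one has length [1/(n+1)] and
    contains [x]. *)
Lemma cell_limitP (a : nat -> int) (x : R) n :
  (forall m, exists y : R, forall i, (i < m)%N ->
    Num.floor (y * i.+1%:R) = a i) ->
  Num.floor (x * n.+1%:R) = a n ->
  `|cell_limit a - x| <= n.+1%:R^-1.
Proof.
move=> H xn.
have fl (y : R) (i : nat) : Num.floor (y * i.+1%:R) = a i ->
    (a i)%:~R / i.+1%:R <= y :> R /\ y < (a i)%:~R / i.+1%:R + i.+1%:R^-1.
  have := floor_mul_itv i (a i) => /(congr1 (@^~ y))/= -> .
  by rewrite in_itv/= => /andP.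
have lej i j : (a i)%:~R / i.+1%:R <= (a j)%:~R / j.+1%:R + j.+1%:R^-1 :> R.
  have [y hy] := H (maxn i j).+1.
  have /fl[+ _] : Num.floor (y * i.+1%:R) = a i.
    by apply: hy; rewrite ltnS leq_maxl.
  move=> /le_trans; apply.
  have /fl[_ /ltW//] : Num.floor (y * j.+1%:R) = a j.
  by apply: hy; rewrite ltnS leq_maxr.
have h1 : (a n)%:~R / n.+1%:R <= cell_limit a.
  apply: ub_le_sup; last by exists n.
  by exists ((a 0%N)%:~R / 1 + 1^-1) => _ [i _ <-]; exact: (lej i 0%N).
have h2 : cell_limit a <= (a n)%:~R / n.+1%:R + n.+1%:R^-1.
  by apply: ge_sup; [exists ((a 0%N)%:~R / 1), 0%N|move=> _ [i _ <-]; exact: lej].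
have [h3 h4] := fl _ _ xn.
rewrite ler_distlC; apply/andP; split.
  by rewrite lerBlDr (le_trans h2)// lerD2r.
by rewrite (le_trans (ltW h4))// lerD2r.
Qed.

Lemma sclosed_cell_limit C (c : nat -> int * int * nat) : sclosed C ->
  (forall m, exists2 p, C p & forall i, (i < m)%N -> code i p = c i) ->
  C (cell_limit (fun i => (c i).1.1), cell_limit (fun i => (c i).1.2),
     fun i => (c i).2).
Proof.
(* Prescribing [n+1] codes includes code [n], whose mesh [1/(n+1)] is the precision demanded by
   [close n]. *)
move=> cC H; apply: cC => n; have [p Cp cp] := H n.+1; exists p => //.
split => /=.
- apply: cell_limitP; last by rewrite -cp.
  by move=> m; have [q _ cq] := H m; exists q.1.1 => i /cq <-.
- apply: cell_limitP; last by rewrite -cp.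
  by move=> m; have [q _ cq] := H m; exists q.1.2 => i /cq <-.
- by move=> i ilt; rewrite -cp// ltnS ltnW.
Qed.

(* If A and B are not separated, some two cells of A and B of level 0 are not,
   then some two subcells of level 1, and so on; both sequences of cells lie
   over the same intervals of the first coordinate, so their limit points, one
   in A and one in B, have the same first coordinate. *)
Lemma lusin_separation A B : sclosed A -> sclosed B ->
  (forall p q, A p -> B q -> p.1.1 <> q.1.1) -> separated A B.
Proof.
move=> cA cB AB; apply: contrapT => nAB.
have /choice[g gP] : forall x : nat * (set W * set W), exists cd,
    ~ separated x.2.1 x.2.2 -> cd.1.1.1 = cd.2.1.1 /\
    ~ separated (cell x.2.1 x.1 cd.1) (cell x.2.2 x.1 cd.2).
  move=> [n [A' B']] /=.
  have [s|/(separated_refine n)[cd h]] := pselect (separated A' B').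
    (* A dummy value for separated pairs, which never occur along [st]. *)
    by exists (0, 0, 0%N, (0, 0, 0%N)).
  by exists cd.
pose st := fix st n := if n is m.+1 then
  (cell (st m).1 m (g (m, st m)).1, cell (st m).2 m (g (m, st m)).2)
  else (A, B).
pose c n := g (n, st n).
have stP n : ~ separated (st n).1 (st n).2.
  by elim: n => //= n IH; case: (gP (n, st n) IH).
have cE n : (c n).1.1.1 = (c n).2.1.1 by case: (gP (n, st n) (stP n)).
have stA n p : (st n).1 p -> A p /\ forall i, (i < n)%N -> code i p = (c i).1.
  elim: n => //= n IH [/IH[Ap ip] np]; split => // i.
  by rewrite ltnS leq_eqVlt => /predU1P[->//|/ip].
have stB n p : (st n).2 p -> B p /\ forall i, (i < n)%N -> code i p = (c i).2.
  elim: n => //= n IH [/IH[Ap ip] np]; split => // i.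
  by rewrite ltnS leq_eqVlt => /predU1P[->//|/ip].
apply: (AB _ _ (sclosed_cell_limit (c := fun i => (c i).1) cA _)
               (sclosed_cell_limit (c := fun i => (c i).2) cB _)) => /=.
(* If no point of [A] had the first [m] codes, the cell [(st m).1] would be empty and [set0] would
   separate the pair. Likewise [setT] for [B] below. *)
- move=> m; apply: contrapT => H; apply: (stP m).
  exists set0 => //; split => [p /stA[Ap ip]|p _ []].
  by case: H; exists p.
- move=> m; apply: contrapT => H; apply: (stP m).
  exists setT => //; split => // p /stB[Bp ip].
  by case: H; exists p.
- by congr cell_limit; apply/funext.
Qed.

(** The parts of the graph above and not above height [c] are Borel, hence analytic. Their
    projections are disjoint and cover the line, so the separating Borel set can only be
    [{a > c}]. *)
Lemma measurable_graph (a : R -> R) :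
  measurable [set x : R * R | x.2 = a x.1] -> measurable_fun setT a.
Proof.
move=> mG; apply: (measurability _ (RGenOInfty.measurableE R)).
move=> _ [_ [c ->] <-]; rewrite setTI.
have mi (i : interval R) :
    measurable ([set x : R * R | x.2 = a x.1] `&` snd @^-1` [set` i]).
  apply: measurableI => //; rewrite -[X in measurable X]setTI.
  exact: measurable_snd.
have [[C cC CE] _] := measurable_bianalytic (mi `]c, +oo[).
have [[D cD DE] _] := measurable_bianalytic (mi `]-oo, c]).
have CP x y s : C (x, y, s) -> y = a x /\ c < a x.
  move=> Cx; have : exists s, C (x, y, s) by exists s.
  by move: (congr1 (@^~ (x, y)) CE) => /= <- [/= ->]; rewrite in_itv/= andbT.
have DP x y s : D (x, y, s) -> y = a x /\ a x <= c.
  move=> Cx; have : exists s, D (x, y, s) by exists s.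
  by move: (congr1 (@^~ (x, y)) DE) => /= <- [/= ->]; rewrite in_itv.
have [|S mS [CS DS]] := lusin_separation cC cD.
  move=> [[x y] s] [[x' y'] s'] /CP[_ h1] /DP[_ h2] /= xx'.
  by move: h1; rewrite xx' ltNge h2.
rewrite (_ : _ @^-1` _ = S)//.
apply/seteqP; split => x /=; rewrite in_itv/= andbT => h.
  have [s Cs] : exists s, C (x, a x, s).
    move: (congr1 (@^~ (x, a x)) CE) => /= <-.
    by split => //=; rewrite in_itv/= h.
  exact: (CS _ Cs).
rewrite ltNge; apply/negP => xc.
have [s Ds] : exists s, D (x, a x, s).
  move: (congr1 (@^~ (x, a x)) DE) => /= <-.
  by split => //=; rewrite in_itv.
exact: (DS _ Ds).
Qed.

End measurable_graph.

(** * Null sets, Fubini and joint measurability *)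

Section ae_lemmas.
Context {R : realType} d (Omega : measurableType d) (P : probability Omega R).

Lemma ae_measurable_setP (d' : measure_display) (S : measurableType d')
    (m : {measure set S -> \bar R}) (E : set S) : measurable E ->
  {ae m, forall w, ~ E w} <-> m E = 0%E.
Proof.
move=> mE; split=> [[N [mN N0 EN]]|E0].
  apply: (subset_measure0 mE mN _ N0) => w Ew; apply: EN => /=; exact.
by exists E; split=> // w /= /contrapT.
Qed.

(** Unique solvability turns the solution set in the [(s, k)] plane into the graph of [a]. Almost
    sure equality means that a section of [E] has probability zero, a measurable condition on
    [(s, k)] by Fubini, so [measurable_graph] applies. *)
Lemma measurable_ae_root (H : R -> R -> Omega -> R) (c : R -> R) :
  measurable_fun setT (fun p : R * R * Omega => H p.1.1 p.1.2 p.2) ->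
  measurable_fun setT c ->
  (forall s, exists! k, 0 <= k /\ {ae P, forall w, H s k w = c s}) ->
  exists2 a : R -> R, measurable_fun setT a &
    forall s k, 0 <= k /\ {ae P, forall w, H s k w = c s} <-> k = a s.
Proof.
move=> mH mc Hu.
have /choice[a aP] : forall s, exists k0,
    forall k, 0 <= k /\ {ae P, forall w, H s k w = c s} <-> k = k0.
  move=> s; have [k0 [h0 hu]] := Hu s; exists k0 => k; split=> [/hu//|->//].
exists a => //; apply: measurable_graph.
pose E := [set p : R * R * Omega | H p.1.1 p.1.2 p.2 - c p.1.1 != 0].
have mE : measurable E.
  have mf : measurable_fun setT
      (fun p : R * R * Omega => H p.1.1 p.1.2 p.2 - c p.1.1).
    apply: measurable_funB => //; apply: measurableT_comp => //.
    exact: (measurableT_comp measurable_fst measurable_fst).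
  rewrite (_ : E = ~` ((fun p => H p.1.1 p.1.2 p.2 - c p.1.1) @^-1` [set 0])).
    by apply: measurableC; rewrite -[X in measurable X]setTI; exact: mf.
  by apply/seteqP; split => p /=; [move/eqP|move=> /eqP].
have -> : [set x : R * R | x.2 = a x.1] =
    snd @^-1` `[0%R, +oo[ `&` (P \o xsection E) @^-1` [set 0%E].
  apply/seteqP; split=> -[s k] /=.
    move=> /aP[k0 hk]; split; first by rewrite in_itv/= k0.
    apply/ae_measurable_setP; first exact: measurable_xsection.
    apply: filterS hk => w hw; rewrite /xsection/= inE /E/= hw subrr.
    by rewrite eqxx.
  move=> [k0 /ae_measurable_setP hk]; apply/aP.
  split; first by move: k0; rewrite in_itv/= andbT.
  apply: filterS (hk (measurable_xsection _ mE)) => w.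
  rewrite /xsection/= inE /E/= => /negP; rewrite negbK.
  by move/eqP/subr0_eq.
apply: measurableI; rewrite -[X in measurable X]setTI.
  exact: measurable_snd.
by apply: (measurable_fun_xsection P mE) => //; exact: emeasurable_set1.
Qed.

(** Both sides say that [E] is null for the product measure: Tonelli equates the integrals of the
    section measures, and a nonnegative function with zero integral vanishes almost everywhere. *)
Lemma ae_prod_swap d1 d2 (S1 : measurableType d1) (S2 : measurableType d2)
    (m1 : {sigma_finite_measure set S1 -> \bar R})
    (m2 : {sigma_finite_measure set S2 -> \bar R}) (E : set (S1 * S2)) :
  measurable E ->
  {ae m1, forall x, {ae m2, forall y, ~ E (x, y)}} ->
  {ae m2, forall y, {ae m1, forall x, ~ E (x, y)}}.
Proof.
move=> mE h1.
have F0 : (\int[m1]_x m2 (xsection E x) = 0)%E.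
  have mF := measurable_fun_xsection m2 mE.
  have /ae_eq_integral_abs : ae_eq m1 setT (m2 \o xsection E) (cst 0%E).
    apply: filterS h1 => x hx _ /=; apply/ae_measurable_setP.
      exact: measurable_xsection.
    by apply: filterS hx => y; rewrite /xsection/= inE.
  move=> /(_ measurableT mF) <-.
  by apply: eq_integral => x _; rewrite gee0_abs// measure_ge0.
have G0 : (\int[m2]_y m1 (ysection E y) = 0)%E.
  have := indic_fubini_tonelli m1 m2 mE.
  by rewrite indic_fubini_tonelli_FE// indic_fubini_tonelli_GE// F0 => <-.
have mG := measurable_fun_ysection m1 mE.
have : ae_eq m2 setT (m1 \o ysection E) (cst 0%E).
  apply/(ae_eq_integral_abs _ measurableT mG); rewrite -[RHS]G0.
  by apply: eq_integral => x _; rewrite gee0_abs// measure_ge0.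
apply: filterS => y /(_ I)/= /ae_measurable_setP.
move=> /(_ (measurable_ysection _ mE)); apply: filterS => x.
by rewrite /ysection/= inE.
Qed.

(** Freezing time at the grid point [r n t] just below [t] gives a countable gluing of random
    variables, and path continuity makes these converge pointwise to [X]. *)
Lemma measurable_continuous_process (X : R -> Omega -> R) :
  (forall t, measurable_fun setT (X t)) ->
  (forall w, continuous (X^~ w)) ->
  measurable_fun setT (fun p : R * Omega => X p.1 p.2).
Proof.
move=> mX cX.
pose r (n : nat) (t : R) : R := (Num.floor (t * n.+1%:R))%:~R / n.+1%:R.
apply: (measurable_fun_cvg (h := fun n p => X (r n p.1) p.2)); last first.
  move=> [t w] _ /=; apply: (@cvg_comp _ _ _ (r^~ t) (X^~ w)); last exact: cX.
  apply/cvgrPdist_le => e e0; near=> n.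
  have n0 : 0 < n.+1%:R :> R by rewrite ltr0n.
  have ne : n.+1%:R^-1 < e.
    by near: n; exact: (near_infty_natSinv_lt (PosNum e0)).
  have : [set x : R | Num.floor (x * n.+1%:R) = Num.floor (t * n.+1%:R)] t by [].
  rewrite floor_mul_itv /= in_itv/= => /andP[h1 h2].
  rewrite ger0_norm ?subr_ge0// lerBlDl ltW// (lt_trans h2)//.
  by rewrite ltrD2l.
move=> n _ Y mY; rewrite setTI.
rewrite (_ : _ @^-1` _ = \bigcup_(z : int)
  (fst @^-1` [set t : R | Num.floor (t * n.+1%:R) = z]
   `&` snd @^-1` (X (z%:~R / n.+1%:R) @^-1` Y))).
  apply: countable_bigcupT_measurable => // z; apply: measurableI.
    rewrite -[X in measurable X]setTI; apply: measurable_fst => //.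
    by rewrite floor_mul_itv; exact: measurable_itv.
  rewrite -[X in measurable X]setTI; apply: measurable_snd => //.
  by rewrite -[X in measurable X]setTI; exact: mX.
apply/seteqP; split => [[t w]/= h|[t w] [z _ [/= <-]]//].
by exists (Num.floor (t * n.+1%:R)).
Unshelve. all: end_near.
Qed.

End ae_lemmas.

(** * Stieltjes measures with a density *)

Section density.
Context {R : realType}.
Local Notation mu := (@lebesgue_measure R).
Variables (T : R) (K : incr0 T) (k : R -> R).
Hypotheses (T0 : 0 <= T) (Kk : is_density T K k).
Local Open Scope ereal_scope.

Let mk : measurable_fun setT (k \_ `[0%R, T]).
Proof.
by apply/(measurable_restrictT _ (measurable_itv _)); case: Kk.
Qed.

Let k0 t : (0 <= (k \_ `[0%R, T]) t)%R.
Proof.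
rewrite patchE; case: ifPn => // /set_mem tT.
by case: Kk => _ + _; exact.
Qed.

Lemma integral_density_ocitv (t : R) :
  \int[mu]_(s in `]-oo, t]) ((k \_ `[0%R, T]) s)%:E = (incr0_ext K t)%:E.
Proof.
have -> : \int[mu]_(s in `]-oo, t]) ((k \_ `[0%R, T]) s)%:E =
    \int[mu]_(s in `]-oo, t]) ((EFin \o k) \_ `[0%R, T]) s.
  by rewrite restrict_EFin.
rewrite -integral_mkcondr /incr0_ext.
have [t0|t0] := ltP t 0%R.
  rewrite (_ : _ `&` _ = set0).
    by rewrite integral_set0 /clamp max_l ?incr0_at0// ge_min (ltW t0).
  apply/seteqP; split => s //=; rewrite !in_itv/= => -[st /andP[s0 _]].
  by have := lt_le_trans t0 s0; rewrite ltNge st.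
have [_ _ ->] := Kk; last exact: clamp_in.
congr integral; apply/seteqP; split => s /=;
  rewrite !in_itv/= /clamp max_r ?le_min ?t0//.
  by move=> [-> /andP[-> ->]].
by move=> /andP[-> /andP[-> ->]].
Qed.

Let nu (A : set (measurableTypeR R)) : \bar R :=
  \int[mu]_(s in A) ((k \_ `[0%R, T]) s)%:E.

Let nu0 : nu set0 = 0. Proof. by rewrite /nu integral_set0. Qed.

Let nu_ge0 A : 0 <= nu A.
Proof. by apply: integral_ge0 => x _; rewrite lee_fin. Qed.

Let nu_sigma_additive : semi_sigma_additive nu.
Proof.
move=> /= F mF tF mUF; rewrite /nu; apply: cvg_toP.
  apply: ereal_nondecreasing_is_cvgn => m n mn.
  by apply: lee_sum_nneg_natr => // i _ _; exact: nu_ge0.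
rewrite ge0_integral_bigcup//=.
- by apply/measurable_funTS/measurable_EFinP.
- by move=> x _; rewrite lee_fin.
Qed.

HB.instance Definition _ := isMeasure.Build _ _ _ nu
  nu0 nu_ge0 nu_sigma_additive.

(** The measure [nu] with density [k] on [[0, T]] and the Stieltjes measure agree on half-open
    intervals, which determine the latter. *)
Lemma lebesgue_stieltjes_measure_density (A : set R) : measurable A ->
  lebesgue_stieltjes_measure (incr0_ext K) A =
  \int[mu]_(s in A) ((k \_ `[0%R, T]) s)%:E.
Proof.
move=> mA.
apply: (@lebesgue_stieltjes_measure_unique R (incr0_ext K) nu _ A mA).
move=> _ /ocitvP[->|[[a b] /= ab ->]].
  by rewrite !measure0.
have -> : lebesgue_stieltjes_measure (incr0_ext K) (`]a, b] : set R) =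
    wlength (incr0_ext K) (`]a, b] : set R).
  rewrite /lebesgue_stieltjes_measure/= /measure_extension/=.
  by rewrite measurable_mu_extE//; exact: is_ocitv.
rewrite wlength_itv_bnd ?ltW//= EFinB -!integral_density_ocitv /nu.
have -> : [set` `]-oo, b]] = `]-oo, a] `|` `]a, b] :> set R.
  by rewrite -itv_bndbnd_setU// bnd_simp ltW.
rewrite ge0_integral_setU//=.
- rewrite integral_density_ocitv addrAC subee ?add0e//.
- by apply/measurable_funTS/measurable_EFinP.
- by move=> x _; rewrite lee_fin.
- apply/disj_setPS => x /=; rewrite !in_itv/= => -[xa /andP[/lt_geF]].
  by rewrite xa.
Qed.

(** The set [N] where [g] differs from zero is null for the Stieltjes measure, that is, [k]
    integrates to zero over [N]; being nonnegative, [k] vanishes almost everywhere there. *)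
Lemma ae_density_eq0 (g : R -> \bar R) :
  measurable_fun `[0%R, T] g -> (forall t, t \in `[0%R, T] -> 0 <= g t) ->
  \int[lebesgue_stieltjes_measure (incr0_ext K)]_(t in `[0%R, T]) g t = 0 ->
  {ae mu, forall t, t \in `[0%R, T] -> g t = 0 \/ k t = 0%R}.
Proof.
move=> mg g0 g_int.
have mI : measurable (`[0%R, T] : set R) by exact: measurable_itv.
pose N := [set` `[0%R, T]] `&` [set t | g t != 0].
have mN : measurable N by exact: emeasurable_neq.
have nuN : lebesgue_stieltjes_measure (incr0_ext K) N = 0.
  have : ae_eq (lebesgue_stieltjes_measure (incr0_ext K)) [set` `[0%R, T]] g (cst 0).
    apply/ae_eq_integral_abs => //; rewrite -[RHS]g_int.
    by apply: eq_integral => t /set_mem tI; rewrite gee0_abs// g0.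
  move=> H; apply/ae_measurable_setP => //; apply: filterS H => t tH [It].
  by rewrite /= tH// eqxx.
move: nuN; rewrite lebesgue_stieltjes_measure_density// => kN.
have : ae_eq mu N (EFin \o (k \_ `[0%R, T])) (cst 0).
  apply/ae_eq_integral_abs => //.
    by apply/measurable_funTS/measurable_EFinP.
  rewrite -[RHS]kN; apply: eq_integral => t _.
  by rewrite gee0_abs// lee_fin.
apply: filterS => t tN tI.
have [|gt0] := eqVneq (g t) 0; [by left|right].
by have := tN (conj tI gt0); rewrite /= patchE mem_set// => -[].
Qed.

End density.

(** * Measurability of processes *)

Section processes.
Context {R : realType} d (Omega : measurableType d) (P : probability Omega R).
Implicit Types (T : R) (F : R -> set (set Omega)) (X : R -> Omega -> R).

Lemma clamp_id T t : t \in `[0, T] -> clamp T t = t.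
Proof. by rewrite in_itv/= /clamp => /andP[t0 tT]; rewrite min_l// max_r. Qed.

(** Clamping time turns data constrained only on [[0, T]] into data on the whole line, where global
    continuity and measurability results apply. *)
Lemma continuous_comp_clamp T (g : R -> R) : 0 <= T ->
  {within `[0, T], continuous g} -> continuous (fun t => g (clamp T t)).
Proof.
move=> T0 /subspace_continuousP gc t.
have tT := clamp_in t T0.
apply: (@cvg_comp _ _ _ (clamp T) g _ _ _ _ (gc _ tT)) => A cA.
have clA : \forall s \near t, clamp T s \in `[0, T] -> A (clamp T s).
  exact: (@continuous_clamp _ T t _ cA).
suff : \forall s \near t, A (clamp T s) by [].
by apply: filterS clA => s; apply; exact: clamp_in.
Qed.

Lemma measurable_clamp T : measurable_fun setT (@clamp R T).
Proof. by apply: continuous_measurable_fun; exact: continuous_clamp. Qed.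

Lemma within_continuous_lipschitz T (C : R) (g : R -> R -> R) (y : R -> R) :
  (forall x, {within `[0, T], continuous (fun t => g t x)}) ->
  (forall t x1 x2, t \in `[0, T] -> `|g t x1 - g t x2| <= C * `|x1 - x2|) ->
  {within `[0, T], continuous y} ->
  {within `[0, T], continuous (fun t => g t (y t))}.
Proof.
move=> gc gL /subspace_continuousP yc; apply/subspace_continuousP => t tT.
have /subspace_continuousP/(_ t tT) gct := gc (y t).
(* The sign of [C] is unknown; [|C| + 1] is a positive Lipschitz constant by which one can
   divide. *)
have C1 : 0 < `|C| + 1 by rewrite ltr_wpDl.
apply/cvgrPdist_le => e e0.
have e2 : 0 < e / 2 by rewrite divr_gt0.
have eC : 0 < e / 2 / (`|C| + 1) by rewrite divr_gt0.
have /cvgrPdist_le/(_ _ e2) h1 := gct.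
have /cvgrPdist_le/(_ _ eC) h2 := yc _ tT.
near=> s.
have sT : s \in `[0, T] by near: s; exact: withinT.
(* First time moves with the state frozen at [y t], then the state moves at time [s]. *)
have -> : g t (y t) - g s (y s) =
    (g t (y t) - g s (y t)) + (g s (y t) - g s (y s)).
  by rewrite addrA subrK.
rewrite [e]splitr (le_trans (ler_normD _ _))// lerD//; first by near: s.
rewrite (le_trans (gL _ _ _ sT))//.
have h : `|y t - y s| <= e / 2 / (`|C| + 1) by near: s.
rewrite (@le_trans _ _ ((`|C| + 1) * `|y t - y s|))//.
  by rewrite ler_wpM2r// (le_trans (ler_norm _))// lerDl.
by rewrite mulrC -ler_pdivlMr.
Unshelve. all: end_near.
Qed.

Lemma measurable_fun_wrt (G : set (set Omega)) (g : Omega -> R) :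
  sigma_algebra setT G -> G `<=` measurable ->
  measurable_wrt G g -> measurable_fun setT g.
Proof.
move=> sG Gm mg _ U mU.
have := mg (@measurableT _ (g_sigma_algebraType G)) U mU.
by rewrite !setTI => h; apply: Gm; rewrite -[G](sigma_algebra_id sG).
Qed.

Lemma measurable_continuous_adapted T F X : 0 <= T -> filtration T F ->
  adapted T F X -> (forall w, {within `[0, T], continuous (fun t => X t w)}) ->
  measurable_fun setT (fun p : R * Omega => X (clamp T p.1) p.2).
Proof.
move=> T0 [Fs _] aX cX.
apply: (@measurable_continuous_process _ _ _ (fun t => X (clamp T t))) => [t|w].
  have [sF Fm] := Fs _ (clamp_in t T0).
  exact: measurable_fun_wrt sF Fm (aX _ (clamp_in t T0)).
exact: continuous_comp_clamp (cX w).
Qed.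

(** Progressive measurability at the final time is joint measurability for [F T], and [F T] lies in
    the ambient sigma-algebra; [h] clamps time and changes the sigma-algebra. *)
Lemma measurable_progressive T F X : 0 <= T -> filtration T F ->
  progressive T F X ->
  measurable_fun setT (fun p : R * Omega => X (clamp T p.1) p.2).
Proof.
move=> T0 [Fs _] pX.
have TT : T \in `[0, T] by rewrite in_itv/= T0 lexx.
have [sF Fm] := Fs _ TT.
pose h (p : R * Omega) : R * g_sigma_algebraType (F T) := (clamp T p.1, p.2).
have mh : measurable_fun setT h.
  apply: measurable_fun_pair.
    exact: measurableT_comp (measurable_clamp T) measurable_fst.
  move=> _ U mU; rewrite setTI -[X in measurable X]setTI.
  apply: measurable_snd => //; apply: Fm.
  by rewrite -[F T](sigma_algebra_id sF).
apply: (measurable_comp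
  (F := [set` `[0, T]] `*` [set: g_sigma_algebraType (F T)]) _ _ (pX T TT) mh).
  by apply: measurableX => //; exact: measurable_itv.
by move=> _ [p _ <-]; split => //=; exact: clamp_in.
Qed.

Lemma measurable_expectation (H : R * Omega -> R) : measurable_fun setT H ->
  measurable_fun setT (fun t => 'E_P[fun w => H (t, w)]%E).
Proof.
move=> mH; have mH' : measurable_fun setT (EFin \o H) by apply/measurable_EFinP.
rewrite (_ : (fun _ => _) = (fun t => fubini_F P (EFin \o H)^\+%E t -
                                      fubini_F P (EFin \o H)^\-%E t)%E).
  apply: emeasurable_funB.
    exact: (measurable_fun_fubini_tonelli_F _ (measurable_funepos mH')).
  exact: (measurable_fun_fubini_tonelli_F _ (measurable_funeneg mH')).
by apply/funext => t; rewrite expectation.unlock integralE /fubini_F !unlock.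
Qed.

(** A finite expectation forces integrability, so [X2 - X1 > 0] would have zero expectation and
    vanish almost surely, contradicting total mass one. *)
Lemma expectation_lt_neq0 (X1 X2 : Omega -> R) :
  measurable_fun setT X1 -> measurable_fun setT X2 ->
  (forall w, X1 w < X2 w) -> 'E_P[X1]%E = 0%E -> 'E_P[X2]%E = 0%E -> False.
Proof.
move=> m1 m2 lt12; rewrite expectation.unlock => E1 E2.
have i1 : P.-integrable setT (EFin \o X1).
  apply/integrableP; split; first exact/measurable_EFinP.
  by rewrite integral_fin_num_abs ?E1.
have i2 : P.-integrable setT (EFin \o X2).
  apply/integrableP; split; first exact/measurable_EFinP.
  by rewrite integral_fin_num_abs ?E2.
have : (\int[P]_w `|(EFin \o X2) w - (EFin \o X1) w| = 0)%E.
  rewrite (eq_integral ((EFin \o X2) \- (EFin \o X1))%E).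
    by rewrite integralB// E1 E2 sube0.
  by move=> w _; rewrite gee0_abs// -EFinB lee_fin subr_ge0 ltW.
have mB : measurable_fun setT ((EFin \o X2) \- (EFin \o X1))%E.
  by apply: emeasurable_funB; exact/measurable_EFinP.
move=> /(ae_eq_integral_abs _ measurableT mB)[N [mN N0 TN]].
have : P setT = 0%E.
  apply: (subset_measure0 _ mN _ N0) => // w _; apply: TN => /= /(_ I)/eqP.
  by rewrite -EFinB eqe subr_eq0 gt_eqF.
by rewrite probability_setT => /eqP; rewrite onee_eq0.
Qed.

End processes.

(** * Increments of the densities and measurability of the driver *)

Section solution.
Context {R : realType} d (Omega : measurableType d) (P : probability Omega R).
Local Notation mu := (@lebesgue_measure R).

Lemma density_integrable T (K : incr0 T) (k : R -> R) : 0 <= T ->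
  is_density T K k -> mu.-integrable `[0, T] (EFin \o k).
Proof.
move=> T0 [mk k0 Kk]; apply/integrableP; split; first exact/measurable_EFinP.
have TT : T \in `[0, T] by rewrite in_itv/= T0 lexx.
have -> : (\int[mu]_(t in `[0%R, T]) `|(EFin \o k) t| =
            \int[mu]_(t in `[0%R, T]) (k t)%:E)%E.
  by apply: eq_integral => t /set_mem tT; rewrite gee0_abs// lee_fin k0.
by rewrite -Kk// ltry.
Qed.

Lemma Rintegral_density T (K : incr0 T) (k : R -> R) t : 0 <= T ->
  is_density T K k -> t \in `[0, T] -> \int[mu]_(s in `[t, T]) k s = K T - K t.
Proof.
move=> T0 dk tT; have ik := density_integrable T0 dk.
have [mk k0 Kk] := dk.
have TT : T \in `[0, T] by rewrite in_itv/= T0 lexx.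
have RK r : r \in `[0, T] -> \int[mu]_(s in `[0, r]) k s = K r.
  by move=> rT; rewrite /Rintegral -(Kk _ rT).
move: (tT); rewrite in_itv/= => /andP[t0 tT'].
rewrite -(RK _ TT) -(RK _ tT) Rintegral_itvB ?bnd_simp//.
rewrite Rintegral_itv_obnd_cbnd//.
apply: integrableS ik => //.
by apply: subset_itvr; rewrite bnd_simp.
Qed.

(** The driver is [f] composed with [h], whose entries are jointly measurable: [Y] by continuity,
    [Z] by progressivity, the means by Fubini. *)
Lemma measurable_mf_driver T F L Up xi f (Y Z : R -> Omega -> R) : 0 <= T ->
  filtration T F -> cond_Lip_k P T F L Up xi f -> S2 P T F Y -> H2 P T F Z ->
  measurable_fun setT
    (fun p : R * R * Omega => mf_driver P f Y Z (clamp T p.1.1) p.1.2 p.2).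
Proof.
move=> T0 HF [_ _ [mf _] _ _] [aY cY _] [pZ _].
have mY := measurable_continuous_adapted T0 HF aY cY.
have mZ := measurable_progressive T0 HF pZ.
have mmean (X : R -> Omega -> R) :
    measurable_fun setT (fun p : R * Omega => X (clamp T p.1) p.2) ->
    measurable_fun setT (fun p : R * R * Omega => mean P (X (clamp T p.1.1))).
  move=> /(measurable_expectation P) mX.
  have mX' : measurable_fun setT (fun t => mean P (X (clamp T t))).
    exact: measurableT_comp (fine_measurable measurableT) mX.
  apply: (measurableT_comp mX').
  exact: measurableT_comp measurable_fst measurable_fst.
have m11 : measurable_fun setT (fun p : R * R * Omega => p.1.1).
  exact: measurableT_comp measurable_fst measurable_fst.
have mpair (X : R -> Omega -> R) :
    measurable_fun setT (fun p : R * Omega => X (clamp T p.1) p.2) ->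
    measurable_fun setT (fun p : R * R * Omega => X (clamp T p.1.1) p.2).
  move=> mX; apply: (measurableT_comp mX (measurable_fun_pair m11 _)).
  exact: measurable_snd.
pose h (p : R * R * Omega) := (clamp T p.1.1, p.2, Y (clamp T p.1.1) p.2,
  mean P (Y (clamp T p.1.1)), Z (clamp T p.1.1) p.2,
  mean P (Z (clamp T p.1.1)), p.1.2).
have mh : measurable_fun setT h.
  do !apply: measurable_fun_pair.
  - exact: measurableT_comp (measurable_clamp T) m11.
  - exact: measurable_snd.
  - exact: mpair.
  - exact: mmean.
  - exact: mpair.
  - exact: mmean.
  - exact: measurableT_comp measurable_snd measurable_fst.
apply: (measurable_comp _ _ mf mh).
  rewrite (_ : [set _ | _] =
    (fst \o fst \o fst \o fst \o fst \o fst) @^-1` `[0, T]); last first.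
    by apply/seteqP; split => p /=; rewrite in_itv.
  rewrite -[X in measurable X]setTI.
  have : measurable_fun setT (fst \o fst \o fst \o fst \o fst \o fst :
      (R * Omega * R * R * R * R * R)%type -> R).
    by do ?[exact: measurable_fst|apply: measurableT_comp].
  by apply => //; exact: measurable_itv.
by move=> _ [p _ <-] /=; have := clamp_in p.1.1 T0; rewrite in_itv.
Qed.

End solution.

(** * Mean losses and disjointness of the two densities *)

Section sol.
Context {R : realType} d (Omega : measurableType d) (P : probability Omega R).
Local Notation mu := (@lebesgue_measure R).

(** The loss along [Y] has continuous paths, since [g] is continuous in time and uniformly Lipschitz
    in space; it is thus jointly measurable and its mean is measurable in time. *)
Lemma measurable_loss T (C : R) F (g : R -> R -> R) (Y : R -> Omega -> R) :
  0 <= T -> filtration T F -> S2 P T F Y ->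
  (forall x, {within `[0, T], continuous (fun t => g t x)}) ->
  (forall t x1 x2, t \in `[0, T] -> `|g t x1 - g t x2| <= C * `|x1 - x2|) ->
  (forall t, t \in `[0, T] -> measurable_fun setT (fun w => g t (Y t w))) /\
  measurable_fun `[0, T] (fun t => 'E_P[fun w => g t (Y t w)]%E).
Proof.
move=> T0 HF [aY cY _] gc gL.
have mg t : measurable_fun setT (fun w => g (clamp T t) (Y (clamp T t) w)).
  have [sF Fm] := HF.1 _ (clamp_in t T0).
  apply: (measurableT_comp _
    (measurable_fun_wrt sF Fm (aY _ (clamp_in t T0)))).
  apply: continuous_measurable_fun => x; apply/cvgrPdist_le => e e0; near=> y.
  rewrite (le_trans (gL _ _ _ (clamp_in t T0)))//.
  have C1 : 0 < `|C| + 1 by rewrite ltr_wpDl.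
  have h : `|x - y| <= e / (`|C| + 1).
    by near: y; apply: cvgr_dist_le; [exact: cvg_id|rewrite divr_gt0].
  rewrite (@le_trans _ _ ((`|C| + 1) * `|x - y|))//.
    by rewrite ler_wpM2r// (le_trans (ler_norm _))// lerDl.
  by rewrite mulrC -ler_pdivlMr.
split => [t /clamp_id <-//|].
apply: (@eq_measurable_fun _ _ _ _ _
    (fun t => 'E_P[fun w => g (clamp T t) (Y (clamp T t) w)]%E)).
  by move=> t /set_mem tT; rewrite clamp_id.
apply: measurable_funTS.
apply: (@measurable_expectation _ _ _ P
  (fun p => g (clamp T p.1) (Y (clamp T p.1) p.2))).
apply: (@measurable_continuous_process _ _ _
    (fun t w => g (clamp T t) (Y (clamp T t) w))) => // w.
apply: (@continuous_comp_clamp _ T (fun t => g t (Y t w))) => //.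
exact: within_continuous_lipschitz gc gL (cY w).
Unshelve. all: end_near.
Qed.

Lemma ae_densities_disjoint T F L Up f xi B (Y Z : R -> Omega -> R) K
    (Kp Km : incr0 T) (kp km : R -> R) : 0 <= T ->
  filtration T F -> cond_LR T L Up ->
  reflected_solution P F B L Up xi f Y Z K Kp Km ->
  is_density T Kp kp -> is_density T Km km ->
  {ae mu, forall t, t \in `[0, T] ->
    [/\ ('E_P[fun w => Up t (Y t w)] = 0)%E \/ kp t = 0,
        ('E_P[fun w => L t (Y t w)] = 0)%E \/ km t = 0 &
        kp t = 0 \/ km t = 0]}.
Proof.
move=> T0 HF [LRc _ _ [c [C [_ _ Lip]]] gap] [[SY _] _ Hmean _ [Hp Hm]] dp dm.
have [mU mEU] := measurable_loss T0 HF SY (fun x => (LRc x).2)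
  (fun t x y tT => proj2 (andP ((Lip t x y tT).2))).
have [mL mEL] := measurable_loss T0 HF SY (fun x => (LRc x).1)
  (fun t x y tT => proj2 (andP ((Lip t x y tT).1))).
have h1 := ae_density_eq0 T0 dp mEU (fun t tT => (Hmean t tT).2) Hp.
(* [ae_density_eq0] takes a nonnegative integrand, whereas the mean of the lower loss is
   nonpositive; hence the sign. *)
have h2 : {ae mu, forall t, t \in `[0, T] ->
    (- 'E_P[fun w => L t (Y t w)] = 0)%E \/ km t = 0}.
  apply: (ae_density_eq0 T0 dm).
  - exact: measurableT_comp mEL.
  - by move=> t tT; rewrite oppe_ge0; exact: (Hmean t tT).1.
  - apply: oppe_inj; rewrite oppe0 -[RHS]Hm -integral_ge0N.
      by apply: eq_integral => t _; rewrite oppeK.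
    by move=> t tT; rewrite oppe_ge0; exact: (Hmean t tT).1.
move: h1 h2; apply: (@filterS2 _ _ (ae_filter_ringOfSetsType mu)) => t h1 h2 tT.
have {}h1 := h1 tT.
have {}h2 : ('E_P[fun w => L t (Y t w)] = 0)%E \/ km t = 0.
  by case: (h2 tT) => [/eqP|]; [rewrite oppe_eq0 => /eqP|]; [left|right].
split => //; case: h1 => [U0|]; last by left.
case: h2 => [L0|]; last by right.
(* The uniform gap, evaluated at [x = Y t w], orders the two losses strictly at every [w]. *)
exfalso; apply: (expectation_lt_neq0 (mL t tT) (mU t tT) _ L0 U0) => w.
rewrite -subr_gt0 -lte_fin; apply: (lt_le_trans gap).
by apply: ereal_inf_lbound; exists (t, Y t w).
Qed.

End sol.

(** * Construction of the solution *)

Lemma ae_eq_integrable d (S : measurableType d) (R : realType)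
    (m : {measure set S -> \bar R}) (D : set S) (g h : S -> \bar R) :
  measurable D -> measurable_fun D g -> ae_eq m D g h ->
  m.-integrable D h -> m.-integrable D g.
Proof.
move=> mD mg gh /integrableP[mh hoo]; apply/integrableP; split => //.
rewrite (ae_eq_integral (abse \o h)) //.
- exact: measurableT_comp.
- exact: measurableT_comp.
- exact: ae_eq_abse.
Qed.

(** This moves the reflection into the drift: over [[t, T]] the density [k1 - k2] contributes
    exactly the increment of [K1 - K2]. *)
Lemma integral_drift_density (R : realType) (T : R) (K1 K2 : incr0 T)
    (k1 k2 g0 g : R -> R) : 0 <= T ->
  is_density T K1 k1 -> is_density T K2 k2 ->
  lebesgue_measure.-integrable `[0, T] (EFin \o g0) ->
  measurable_fun `[0, T] g ->
  {ae lebesgue_measure, forall s, s \in `[0, T] ->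
    g s = g0 s + (k1 s - k2 s)} ->
  lebesgue_measure.-integrable `[0, T] (EFin \o g) /\
  forall t, t \in `[0, T] -> \int[lebesgue_measure]_(s in `[t, T]) g s =
    \int[lebesgue_measure]_(s in `[t, T]) g0 s +
      (K1 T - K1 t - (K2 T - K2 t)).
Proof.
move=> T0 d1 d2 i0 mg gE.
have mI : measurable ([set` `[0, T]] : set (measurableTypeR R)).
  exact: measurable_itv.
have i1 := density_integrable T0 d1.
have i2 := density_integrable T0 d2.
have i12 : lebesgue_measure.-integrable `[0, T] (EFin \o (k1 \- k2)).
  by have -> : EFin \o (k1 \- k2) = ((EFin \o k1) \- (EFin \o k2))%E by [];
    exact: integrableB.
have ih : lebesgue_measure.-integrable `[0, T] (EFin \o (g0 \+ (k1 \- k2))).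
  by have -> : EFin \o (g0 \+ (k1 \- k2)) =
      ((EFin \o g0) \+ (EFin \o (k1 \- k2)%R))%E by [];
    exact: integrableD.
have fmu := ae_filter_ringOfSetsType (@lebesgue_measure R).
have gh : ae_eq lebesgue_measure [set` `[0, T]]
    (EFin \o g) (EFin \o (g0 \+ (k1 \- k2))).
  by apply: filterS gE => s gs sT /=; rewrite gs.
split.
  by apply: (@ae_eq_integrable _ (measurableTypeR R) R lebesgue_measure _ _ _
    mI _ gh ih); exact/measurable_EFinP.
move=> t tT.
have sub : [set` `[t, T]] `<=` [set` `[0, T]].
  move: tT; rewrite in_itv/= => /andP[t0 _].
  by apply: subset_itvr; rewrite bnd_simp.
have mt : measurable ([set` `[t, T]] : set R) by exact: measurable_itv.
have iS (k : R -> R) :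
    lebesgue_measure.-integrable [set` `[0, T]] (EFin \o k) ->
    lebesgue_measure.-integrable [set` `[t, T]] (EFin \o k).
  exact: integrableS.
rewrite -(Rintegral_density T0 d1 tT) -(Rintegral_density T0 d2 tT).
rewrite -RintegralB//; [|exact: iS|exact: iS].
rewrite -RintegralD//; [|exact: iS|exact: iS].
rewrite /Rintegral; congr fine; apply: ae_eq_integral => //.
- by apply/measurable_EFinP; exact: measurable_funS mg.
- by have /integrableP[] := iS _ ih.
- exact: ae_eq_subset gh.
Qed.

(** Transfers flatness from the old density [l] to the new one [k], which vanishes wherever [l]
    does. *)
Lemma integral_mul_eq0 (R : realType) (T : R) (u : R -> \bar R) (k l : R -> R) :
  measurable_fun `[0, T] u -> measurable_fun setT k ->
  (forall s, s \in `[0, T] -> l s = 0 -> k s = 0) ->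
  {ae lebesgue_measure, forall s, s \in `[0, T] -> u s = 0%E \/ l s = 0} ->
  (\int[lebesgue_measure]_(t in `[0%R, T]) (u t * (k t)%:E) = 0)%E.
Proof.
move=> mu mk k0 ul; rewrite (ae_eq_integral (cst 0%E)) ?integral0//.
  apply: emeasurable_funM => //; apply/measurable_EFinP.
  exact: measurable_funS mk.
have fmu := ae_filter_ringOfSetsType (@lebesgue_measure R).
apply: filterS ul => s Hs sT.
by have [->|/(k0 _ sT) ->] := Hs sT; rewrite ?mul0e ?mule0.
Qed.

Theorem theorem5p5 (R : realType) (d : measure_display)
  (Omega : measurableType d) (P : probability Omega R)
  (T : R) (F : R -> set (set Omega)) (B : R -> Omega -> R)
  (L Up : R -> R -> R) (xi : Omega -> R)
  (f : R -> Omega -> R -> R -> R -> R -> R -> R)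
  (Y Z : R -> Omega -> R) (K : R -> R) (Kp Km : incr0 T) (kp km : R -> R) :
  0 < T ->
  filtration T F ->
  usual_conditions P T F ->
  brownian_motion P T F B ->
  (forall t, t \in `[0, T] -> F t = augmented_natural_filtration P B t) ->
  cond_LR T L Up ->
  C12b T L -> C12b T Up ->
  cond_Lip_k P T F L Up xi f ->
  reflected_solution P F B L Up xi f Y Z K Kp Km ->
  (ereal_sup [set 'E_P[fun w => (`|Z t w| ^+ 2)%R] | t in `[0%R, T]]
     < +oo)%E ->
  is_density T Kp kp -> is_density T Km km ->
  (forall s, s \in `[0, T] ->
     (exists! k : R, 0 <= k /\
        {ae P, forall w, mf_driver P f Y Z s k w - mf_driver P f Y Z s 0 w + k
                         = kp s}) /\
     (exists! k : R, 0 <= k /\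
        {ae P, forall w, mf_driver P f Y Z s (- k) w - mf_driver P f Y Z s 0 w - k
                         = - km s})) ->
  exists (Y' Z' : R -> Omega -> R) (k : R -> R),
    resistance_solution P T F B L Up xi f Y' Z' k.
Proof.
move=> T0' HF _ _ _ HLR _ _ HLip Hsol _ dp dm Hex.
have T0 := ltW T0'.
have fmu := ae_filter_ringOfSetsType (@lebesgue_measure R).
have [[SY [HZ _]] [M [HM Hback]] Hmean HK _] := Hsol.
have [mkp kp0 _] := dp.
have [mkm km0 _] := dm.
have mI : measurable ([set` `[0, T]] : set R) by exact: measurable_itv.
have [LRc _ _ [c [C [_ _ Lip]]] _] := HLR.
have mclamp (k : R -> R) : measurable_fun `[0, T] k ->
    measurable_fun setT (fun s => k (clamp T s)).
  move=> mk; apply: (measurable_comp mI _ mk (measurable_clamp T)).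
  by move=> _ [s _ <-]; exact: clamp_in.
have mD := measurable_mf_driver T0 HF HLip SY HZ.
have mDk (h : R * R -> R) : measurable_fun setT h ->
    measurable_fun setT (fun p : R * R * Omega =>
      mf_driver P f Y Z (clamp T p.1.1) (h p.1) p.2).
  move=> mh; apply: (measurableT_comp mD (g := fun p => (p.1.1, h p.1, p.2))).
  apply: measurable_fun_pair; last exact: measurable_snd.
  apply: measurable_fun_pair; last exact: measurableT_comp mh measurable_fst.
  exact: measurableT_comp measurable_fst measurable_fst.
have m2 : measurable_fun setT (fun p : R * R * Omega => p.1.2).
  exact: measurableT_comp measurable_snd measurable_fst.
(* With time clamped the root equation is uniquely solvable for every real [s], as
   [measurable_ae_root] requires. *)
have [a ma aP] : exists2 a : R -> R, measurable_fun setT a & forall s k,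
    0 <= k /\ {ae P, forall w, mf_driver P f Y Z (clamp T s) k w
      - mf_driver P f Y Z (clamp T s) 0 w + k = kp (clamp T s)} <-> k = a s.
  apply: (measurable_ae_root (c := fun s => kp (clamp T s))
    (H := fun s k w => mf_driver P f Y Z (clamp T s) k w
      - mf_driver P f Y Z (clamp T s) 0 w + k)).
  - apply: measurable_funD => //; apply: measurable_funB => //.
    exact: (mDk (fun=> 0)).
  - exact: mclamp.
  - by move=> s; exact: (Hex _ (clamp_in s T0)).1.
have [b mb bP] : exists2 b : R -> R, measurable_fun setT b & forall s k,
    0 <= k /\ {ae P, forall w, mf_driver P f Y Z (clamp T s) (- k) w
      - mf_driver P f Y Z (clamp T s) 0 w - k = - km (clamp T s)} <-> k = b s.
  apply: (measurable_ae_root (c := fun s => - km (clamp T s))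
    (H := fun s k w => mf_driver P f Y Z (clamp T s) (- k) w
      - mf_driver P f Y Z (clamp T s) 0 w - k)).
  - apply: measurable_funB => //; apply: measurable_funB.
      by apply: (mDk (fun x => - x.2)); exact: measurableT_comp measurable_snd.
    exact: (mDk (fun=> 0)).
  - by apply: measurableT_comp => //; exact: mclamp.
  - by move=> s; exact: (Hex _ (clamp_in s T0)).2.
have a_ge0 s : 0 <= a s by have [_ /(_ erefl)[]] := aP s (a s).
have b_ge0 s : 0 <= b s by have [_ /(_ erefl)[]] := bP s (b s).
have a_eq0 s : s \in `[0, T] -> kp s = 0 -> a s = 0.
  (* Zero solves the equation when its right-hand side is zero, and the solution is unique. *)
  move=> sT kps; apply/esym/aP; split => //; apply: aeW => w.
  by rewrite clamp_id// kps subrr add0r.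
have b_eq0 s : s \in `[0, T] -> km s = 0 -> b s = 0.
  move=> sT kms; apply/esym/bP; split => //; apply: aeW => w.
  by rewrite clamp_id// kms oppr0 subrr addr0.
have Hd := ae_densities_disjoint T0 HF HLR Hsol dp dm.
have driverE s : s \in `[0, T] -> kp s = 0 \/ km s = 0 ->
    {ae P, forall w, mf_driver P f Y Z s (a s - b s) w + (a s - b s)
                     = mf_driver P f Y Z s 0 w + (kp s - km s)}.
  (* One of [a s], [b s] is zero, so [k] equals [- b s] or [a s], and the matching auxiliary
     equation is the claim. *)
  move=> sT [kps|kms].
    rewrite (a_eq0 _ sT kps) kps !sub0r.
    have [_ /(_ erefl)[_]] := bP s (b s); rewrite clamp_id//.
    by apply: filterS => w <-; ring.
  rewrite (b_eq0 _ sT kms) kms !subr0.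
  have [_ /(_ erefl)[_]] := aP s (a s); rewrite clamp_id//.
  by apply: filterS => w <-; ring.
(* The new drift [g] and the old drift plus reflection rate [h], clamped so as to be jointly
   measurable. *)
pose g s w := mf_driver P f Y Z (clamp T s) (a s - b s) w + (a s - b s).
pose h s w :=
  mf_driver P f Y Z (clamp T s) 0 w + (kp (clamp T s) - km (clamp T s)).
have mg : measurable_fun setT (fun p : R * Omega => g p.1 p.2).
  have mab : measurable_fun setT (fun p : R * Omega => a p.1 - b p.1).
    by apply: measurable_funB; [exact: measurableT_comp ma measurable_fst|
      exact: measurableT_comp mb measurable_fst].
  apply: measurable_funD => //.
  apply: (measurableT_comp mD
    (g := fun p : R * Omega => (p.1, a p.1 - b p.1, p.2))).
  apply: measurable_fun_pair; last exact: measurable_snd.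
  by apply: measurable_fun_pair => //; exact: measurable_fst.
have mh : measurable_fun setT (fun p : R * Omega => h p.1 p.2).
  apply: measurable_funD.
    apply: (measurableT_comp mD (g := fun p : R * Omega => (p.1, 0 : R, p.2))).
    apply: measurable_fun_pair; last exact: measurable_snd.
    by apply: measurable_fun_pair => //; exact: measurable_fst.
  by apply: measurable_funB;
    [exact: measurableT_comp (mclamp _ mkp) measurable_fst|
     exact: measurableT_comp (mclamp _ mkm) measurable_fst].
(* [driverE] has an exceptional set of [w] depending on [s]; the equation is pathwise, so the two
   quantifiers are exchanged by Fubini. *)
have gh : {ae P, forall w, {ae @lebesgue_measure R, forall s,
    ~ (s \in `[0, T] /\ g s w - h s w <> 0)}}.
  apply: (@ae_prod_swap _ _ _ _ _ lebesgue_measure P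
    [set p : R * Omega | p.1 \in `[0, T] /\ g p.1 p.2 - h p.1 p.2 <> 0]).
    rewrite (_ : [set _ | _] = fst @^-1` [set` `[0, T]] `&`
      ~` ((fun p => g p.1 p.2 - h p.1 p.2) @^-1` [set 0])); last by [].
    apply: measurableI.
      by rewrite -[X in measurable X]setTI; exact: measurable_fst.
    by apply: measurableC; rewrite -[X in measurable X]setTI;
      exact: measurable_funB.
  apply: filterS Hd.
  move=> s Hs; have [sT|sT] := boolP (s \in `[0, T]); last first.
    by apply: aeW => w [/=]; rewrite (negPf sT).
  have [_ _ /(driverE _ sT)] := Hs sT; apply: filterS => w gw [_]; apply.
  by rewrite /= /g /h clamp_id// gw subrr.
exists Y, Z, (fun s => a s - b s); split.
- split => //; split => //; apply: measurable_funTS.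
  exact: measurable_funB.
(* Since [Z] is kept, so is its stochastic integral [M]; only the drift changes, and it absorbs the
   increment of [K]. *)
- exists M; split => //; move: Hback gh; apply: filterS2 => w [ig0 Yw] ghw.
  have gg' : {in [set` `[0, T]], g^~ w =1
      fun s => mf_driver P f Y Z s (a s - b s) w + (a s - b s)}.
    by move=> s /set_mem sT; rewrite /g clamp_id.
  have [] := @integral_drift_density _ _ _ _ _ _ _
    (fun s => mf_driver P f Y Z s (a s - b s) w + (a s - b s)) T0 dp dm ig0.
  - apply: (@eq_measurable_fun _ _ _ _ _ (g^~ w)); first exact: gg'.
    apply: measurable_funTS.
    exact: (measurable_fun_pair1 w mg).
  - apply: filterS ghw => s Hs sT.
    apply: subr0_eq; apply: contrapT => ne; apply: Hs.
    by split => //; rewrite /g /h clamp_id.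
  move=> ig gE; split => // t tT; rewrite subrr addr0 (Yw t tT) gE// !HK//.
    by ring.
  by rewrite in_itv/= T0 lexx.
- by [].
- exists a, b; split.
  + by split; exact: measurable_funTS.
  + by [].
  + have [_ mEU] := measurable_loss T0 HF SY (fun x => (LRc x).2)
      (fun t x y tT => proj2 (andP ((Lip t x y tT).2))).
    have [_ mEL] := measurable_loss T0 HF SY (fun x => (LRc x).1)
      (fun t x y tT => proj2 (andP ((Lip t x y tT).1))).
    split.
      apply: integral_mul_eq0 mEU ma a_eq0 _.
      apply: filterS Hd.
      by move=> s Hs /Hs[].
    apply: integral_mul_eq0 mEL mb b_eq0 _.
    apply: filterS Hd.
    by move=> s Hs /Hs[].
Qed.
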